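(* Let $r\ge 3$, $k\ge 2$ be integers and let $n\ge (r-1)k+1+\binom{(r-1)k-1}{r-1}$ be an integer with $k\mid n$. Then there exists an integer $m$ with $1\le m<k$ such that $$T\big(n,K_{(r-1)k+1}^{(r)};k\big)\ge T\big(n,K_{(r-1)k+1}^{(r)};m\big).$$
   Context: An $r$-graph is a pair $H=(V,E)$ with $V$ a finite vertex set and $E$ a set of $r$-element subsets of $V$; connected components are in the usual sense (isolated vertices count as components). For integers $K>r$, say an $r$-graph satisfies the covering condition for $K$ if every $K$-element subset of its vertex set contains at least one edge. For an integer $m\ge1$, $T(n,K_K^{(r)};m)$ denotes the smallest integer $t$ such that there exists an $r$-graph with $n$ vertices, $t$ edges and exactly $m$ connected components satisfying the covering condition for $K$. *)

(* Defs.v *)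
From mathcomp Require Import all_boot.

Set Implicit Arguments.
Unset Strict Implicit.
Unset Printing Implicit Defensive.

(* A hypergraph on the vertex type V is given by its set of edges. *)

Definition is_rgraph (V : finType) (r : nat) (E : {set {set V}}) : Prop :=
  forall e : {set V}, e \in E -> #|e| = r.

Definition adj (V : finType) (E : {set {set V}}) : rel V :=
  fun x y => [exists e in E, (x \in e) && (y \in e)].

(* [n_comp] counts the classes of the reflexive transitive closure of [adj E],
   so every isolated vertex is a component by itself. *)
Definition num_components (V : finType) (E : {set {set V}}) : nat :=
  n_comp (adj E) V.

Definition covering (V : finType) (K : nat) (E : {set {set V}}) : Prop :=
  forall S : {set V}, #|S| = K -> exists2 e : {set V}, e \in E & e \subset S.

(* The n vertices are labelled by 'I_n; the properties involved are invariant
   under isomorphism. *)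
Definition turan_realizable (r n K m t : nat) : Prop :=
  exists E : {set {set 'I_n}},
    [/\ is_rgraph r E, #|E| = t, num_components E = m & covering K E].

(* [is_turan r n K m t] reads T(n, K_K^(r); m) = t.  It is a relation because
   the minimum need not exist for every choice of the parameters. *)
Definition is_turan (r n K m t : nat) : Prop :=
  turan_realizable r n K m t /\
  forall t' : nat, turan_realizable r n K m t' -> t <= t'.

(* [n_comp] is only meaningful for a relation whose closure is symmetric. *)
Lemma adj_connect_sym (V : finType) (E : {set {set V}}) : connect_sym (adj E).
Proof.
apply: sym_connect_sym => x y; rewrite /adj.
by apply: eq_existsb => e; rewrite [(x \in e) && _]andbC.
Qed.

(* Main.v *)
(* Let H be a smallest covering r-graph with k components, and K = (r-1)k+1.

   If H has no isolated vertex, every component must be complete, so by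
   convexity H has at least k C(n/k, r) edges, the number of edges of k disjoint
   cliques on n/k vertices.  In two of these cliques, on A and B, choose
   (r-1)-sets P and Q and trade the edges P + a and Q + b (a in A, b in B) for
   P + b and Q + a: the number of edges is unchanged, the covering condition
   survives, and the two components merge.

   If v is isolated in H, the lower bound on n and a pigeonhole argument on a
   maximal independent set give two edges e, f sharing r - 1 vertices.  For x in
   both, replacing e by e - x + v preserves the covering condition: a K-set
   S avoiding v and containing x contains an edge of H other than e, because
   S - x + v does.  The new edge attaches v, while f keeps x attached. *)

Require Import Defs.
From mathcomp Require Import all_boot.
From mathcomp Require Import zify.

(** * Subsets of given size, colour classes and convexity of binomials *)

Lemma subset_between {T : finType} (C A : {set T}) (m : nat) :
  C \subset A -> #|C| <= m <= #|A| ->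
  exists B : {set T}, [/\ C \subset B, B \subset A & #|B| = m].
Proof.
move=> sCA /andP[leCm lemA].
have : 0 < #|[set D : {set T} | D \subset A :\: C & #|D| == m - #|C|]|.
  rewrite cards_draws bin_gt0 cardsD (setIidPr sCA); lia.
case/card_gt0P=> D /[!inE] /andP[sD /eqP cD].
have sDA : D \subset A by apply: subset_trans sD (subsetDl _ _).
exists (C :|: D); split; first exact: subsetUl.
  by rewrite subUset sCA.
have -> : #|C :|: D| = #|C| + #|D|.
  apply/eqP; rewrite (leq_card_setU C D) disjoint_sym.
  by apply: disjointWl sD _; rewrite -setI_eq0 setIDAC setDIl setDv setI0.
by rewrite cD subnKC.
Qed.

Lemma subset_of_card {T : finType} (A : {set T}) (m : nat) :
  m <= #|A| -> exists2 B : {set T}, B \subset A & #|B| = m.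
Proof.
move=> lemA.
have [|B [_ sBA cB]] := @subset_between T set0 A m (sub0set A).
  by rewrite cards0.
by exists B.
Qed.

Lemma sum_card_fibers {V T : finType} (c : V -> T) (S : {set V}) :
  \sum_(i : T) #|S :&: [set x | c x == i]| = #|S|.
Proof.
rewrite -[RHS]sum1_card (partition_big c predT) //=.
by apply: eq_bigr => i _; rewrite -sum1_card; apply: eq_bigl => x; rewrite !inE.
Qed.

(** The disjoint union of complete [r]-graphs on the colour classes. It is used both with
    [c := root (adj E)], whose nonempty classes are the components of [E], and with an equitable
    colouring. *)
Definition mono_edges {V T : finType} (r : nat) (c : V -> T) : {set {set V}} :=
  [set e : {set V} | (#|e| == r) && [exists i, e \subset [set x | c x == i]]].

Lemma card_mono_edges {V T : finType} (r : nat) (c : V -> T) :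
  0 < r ->
  #|mono_edges r c| = \sum_(i : T) 'C(#|[set x | c x == i]|, r).
Proof.
move=> r0; pose F i := [set e : {set V} | e \subset [set x | c x == i] & #|e| == r].
have -> : mono_edges r c = \bigcup_i F i.
  apply/setP=> e; rewrite inE; apply/andP/bigcupP.
    by case=> cE /existsP[i sE]; exists i; rewrite // inE sE.
  by case=> i _ /[!inE] /andP[sE ->]; split=> //; apply/existsP; exists i.
rewrite -sum1_card partition_disjoint_bigcup /=.
  by apply: eq_bigr => i _; rewrite sum1_card cards_draws.
move=> i j neq; rewrite -setI_eq0; apply/eqP/setP=> e; rewrite !inE.
apply/negP=> /andP[/andP[si /eqP ce] /andP[sj _]].
have /card_gt0P[x xe] : 0 < #|e| by rewrite ce.
move/subsetP/(_ x xe): si; move/subsetP/(_ x xe): sj; rewrite !inE => /eqP-> /eqP ij.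
by rewrite ij eqxx in neq.
Qed.

(* The tangent line of the convex function [m |-> 'C(m, r.+1)] at [s], with
   both sides shifted so that no subtraction occurs. *)
Lemma bin_tangent (r s m : nat) :
  'C(s, r.+1) + m * 'C(s, r) <= 'C(m, r.+1) + s * 'C(s, r).
Proof.
(* By Pascal's rule each step above [s] gains at least ['C(s, r)], and each step below [s] loses at
   most ['C(s, r)]. *)
have up d : 'C(s, r.+1) + d * 'C(s, r) <= 'C(s + d, r.+1).
  elim: d => [|d IH]; first by rewrite addn0 mul0n addn0.
  rewrite addnS binS mulSn.
  have := @leq_bin2l s (s + d) r (leq_addr _ _); lia.
have down d : d <= s -> 'C(s, r.+1) <= 'C(s - d, r.+1) + d * 'C(s, r).
  elim: d => [|d IH] lt; first by rewrite subn0 addn0.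
  have := IH (ltnW lt).
  have -> : s - d = (s - d.+1).+1 by lia.
  rewrite binS mulSn.
  have := @leq_bin2l (s - d.+1) s r (leq_subr _ _); lia.
case: (leqP s m) => h.
  have := up (m - s); rewrite subnKC // mulnBl.
  have : s * 'C(s, r) <= m * 'C(s, r) by rewrite leq_mul2r h orbT.
  lia.
have := down (s - m) (leq_subr _ _); rewrite subKn ?(ltnW h) // mulnBl.
have : m * 'C(s, r) <= s * 'C(s, r) by rewrite leq_mul2r ltnW ?orbT.
lia.
Qed.

(** Jensen's inequality: the tangent lines are taken at the mean [s], so their linear terms cancel
    in the sum. *)
Lemma sum_bin_ge {T : finType} (A : {set T}) (f : T -> nat) (r s : nat) :
  \sum_(i in A) f i = #|A| * s ->
  #|A| * 'C(s, r.+1) <= \sum_(i in A) 'C(f i, r.+1).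
Proof.
move=> sumf.
have : \sum_(i in A) ('C(s, r.+1) + f i * 'C(s, r)) <=
       \sum_(i in A) ('C(f i, r.+1) + s * 'C(s, r)).
  by apply: leq_sum => i _; apply: bin_tangent.
by rewrite !big_split /= -big_distrl /= sumf !sum_nat_const -mulnA leq_add2r.
Qed.

(** * Connectivity and the number of components *)

Definition isolated {V : finType} (E : {set {set V}}) (v : V) : Prop :=
  forall e, e \in E -> v \notin e.

Lemma adjP {V : finType} {E : {set {set V}}} {x y : V} :
  reflect (exists2 e, e \in E & x \in e /\ y \in e) (adj E x y).
Proof.
apply: (iffP existsP) => [[e /and3P[? ? ?]]|[e ? [? ?]]]; exists e => //.
by apply/and3P.
Qed.

Lemma connect_edge {V : finType} (E : {set {set V}}) (e : {set V}) (x y : V) :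
  e \in E -> x \in e -> y \in e -> connect (adj E) x y.
Proof. by move=> eE xe ye; apply/connect1/adjP; exists e. Qed.

Lemma connect_invariant {V : finType} {T : eqType} (e : rel V) (c : V -> T) :
  (forall x y, e x y -> c x = c y) -> forall x y, connect e x y -> c x = c y.
Proof.
move=> ec x y /connectP[p]; elim: p x => [|z p IH] x /= => [_ -> //|].
by case/andP=> /ec -> ? ?; apply: IH.
Qed.

(** The colouring [c] restricts to a bijection from the component roots to [T]. *)
Lemma num_components_classes {V T : finType} (E : {set {set V}}) (c : V -> T) :
  (forall x y, connect (adj E) x y = (c x == c y)) ->
  (forall i, exists x, c x = i) ->
  num_components E = #|T|.
Proof.
move=> Ec surj; have sym := adj_connect_sym E.
have inj : {in roots (adj E) &, injective c}.
  move=> x y /eqP rx /eqP ry /eqP; rewrite -Ec => /(rootP sym).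
  by rewrite rx ry.
rewrite /num_components /n_comp_mem -(card_in_imset (f := c)); last first.
  by move=> x y /andP[rx _] /andP[ry _]; apply: inj.
rewrite -cardsT; apply: eq_card => i; rewrite [RHS]inE; apply/imsetP.
have [x xi] := surj i; exists (root (adj E) x).
  by rewrite inE /= andbT; apply: roots_root.
by rewrite -xi; apply/eqP; rewrite -Ec connect_root.
Qed.

(** Taking [E']-roots maps the [E]-roots onto the [E']-roots, and it remains onto after [rt x] is
    removed, because [rt y] has the same image. *)
Lemma num_components_lt {V : finType} (E E' : {set {set V}}) (x y : V) :
  subrel (connect (adj E)) (connect (adj E')) ->
  connect (adj E') x y -> ~~ connect (adj E) x y ->
  num_components E' < num_components E.
Proof.
move=> sub xy' nxy; have sym := adj_connect_sym E; have sym' := adj_connect_sym E'.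
pose rt := root (adj E); pose rt' := root (adj E').
pose R := [set z | roots (adj E) z]; pose R' := [set z | roots (adj E') z].
have rtK z : rt' (rt z) = rt' z.
  by apply/esym/(rootP sym')/sub/connect_root.
have nE : num_components E = #|R|.
  by apply: eq_card => z; rewrite !inE andbT.
have nE' : num_components E' = #|R'|.
  by apply: eq_card => z; rewrite !inE andbT.
have xR : rt x \in R by rewrite inE roots_root.
rewrite nE nE' (cardsD1 (rt x) R) xR add1n ltnS.
apply: leq_trans (leq_imset_card rt' _); apply: subset_leq_card.
apply/subsetP=> z /[!inE] /eqP rz; apply/imsetP.
case: (eqVneq (rt z) (rt x)) => [zx|zx]; last first.
  by exists (rt z); rewrite ?inE ?zx ?roots_root //= rtK.
exists (rt y); first rewrite !inE roots_root // andbT.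
  by apply: contra nxy => /eqP yx; apply/(rootP sym).
by rewrite rtK -{1}rz -[root _ z]rtK zx rtK; apply/(rootP sym').
Qed.

Lemma num_components_gt0 {V : finType} (E : {set {set V}}) (x : V) :
  0 < num_components E.
Proof.
apply/card_gt0P; exists (root (adj E) x); rewrite inE /= andbT.
exact: roots_root (adj_connect_sym E) x.
Qed.

(** * Coverings without isolated vertices *)

Lemma edge_in_class {V : finType} (E : {set {set V}}) (e : {set V}) (x : V) :
  e \in E -> x \in e ->
  e \subset [set y | root (adj E) y == root (adj E) x].
Proof.
move=> eE xe; apply/subsetP=> y ye; rewrite inE (root_connect (adj_connect_sym E)).
exact: connect_edge eE ye xe.
Qed.

(* A missing r-subset of a component, together with r - 1 vertices from each
   other component, would be a K-set without an edge. *)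
Lemma components_complete {V : finType} (r k : nat) (E : {set {set V}}) :
  0 < r -> is_rgraph r E -> num_components E = k ->
  covering ((r - 1) * k + 1) E -> (forall v, ~ isolated E v) ->
  mono_edges r (root (adj E)) \subset E.
Proof.
move=> r0 rE cE cov noiso; pose c := root (adj E).
pose C i := [set x | c x == i]; have sym := adj_connect_sym E.
have big i : roots (adj E) i -> r <= #|C i|.
  move=> /eqP ri; case: (boolP [exists e in E, i \in e]) => [/existsP[e /andP[eE ie]]|no].
    have := edge_in_class E e i eE ie; rewrite ri => /subset_leq_card.
    by rewrite (rE e eE).
  case: (noiso i) => e eE; apply: contra no => ie.
  by apply/existsP; exists e; rewrite eE.
apply/subsetP=> f /[!inE] /andP[/eqP cf /existsP[i sfi]].
have [x xf] : exists x, x \in f by apply/card_gt0P; rewrite cf.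
have ri : roots (adj E) i.
  by move/subsetP/(_ x xf): sfi; rewrite inE => /eqP <-; apply: roots_root.
(* The labels [j] range over all vertices, so the factor [roots (adj E) j], read as 0 or 1, makes
   [T j] empty when [j] is not a root. *)
have /fin_all_exists[T Tprop] j : exists B : {set V},
    [/\ B \subset C j, j != i -> #|B| = (r - 1) * roots (adj E) j & j = i -> B = f].
  case: (eqVneq j i) => [->|ji]; first by exists f; split.
  have [|B sB cB] := subset_of_card (C j) ((r - 1) * roots (adj E) j).
    case: (boolP (roots (adj E) j)) => [/big|_]; rewrite ?muln0 //; lia.
  by exists B; split=> // eji; rewrite eji eqxx in ji.
pose S := [set x | x \in T (c x)].
have ST j : S :&: C j = T j.
  have [/subsetP sT _ _] := Tprop j; apply/setP=> y; rewrite !inE.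
  apply/andP/idP => [[yT /eqP<-//]|yT]; have := sT y yT.
  by rewrite inE => /eqP ->.
have cS : #|S| = (r - 1) * k + 1.
  rewrite -(sum_card_fibers c) (bigD1 i) //= ST.
  have [_ _ ->//] := Tprop i.
  rewrite (eq_bigr (fun j => (r - 1) * roots (adj E) j)); last first.
    by move=> j ji; rewrite ST; have [_ ->] := Tprop j.
  rewrite -big_distrr /=.
  have : k = \sum_j roots (adj E) j.
    rewrite -cE /num_components /n_comp_mem -sum1_card big_mkcond /=.
    by apply: eq_bigr => j _; rewrite inE /= andbT; case: (roots _ _).
  (* The count is r + (r - 1)(k - 1) = (r - 1)k + 1. *)
  rewrite (bigD1 i) //= ri cf => ->; nia.
have [e eE /subsetP seS] := cov S cS.
have [y ye] : exists y, y \in e by apply/card_gt0P; rewrite rE.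
have seT : e \subset T (c y).
  rewrite -ST subsetI; apply/andP; split; first exact/subsetP.
  exact: edge_in_class.
have [_ Tne Teq] := Tprop (c y).
(* The edge [e] lies in a single component. A component other than [i] contributes fewer than r
   vertices to [S], so [e] lies in [f] and equals it. *)
case: (eqVneq (c y) i) => [cyi|cyi].
  rewrite (Teq cyi) in seT; suff -> : f = e by [].
  by apply/esym/eqP; rewrite eqEcard seT cf rE //=.
move/subset_leq_card: seT; rewrite (Tne cyi) rE //.
by case: (roots _ _) => /=; lia.
Qed.

(** The components are complete and their mean size is [s], so convexity bounds the number of
    edges. *)
Lemma no_isolated_card {V : finType} (r k s : nat) (E : {set {set V}}) :
  0 < r -> is_rgraph r E -> num_components E = k -> #|V| = k * s ->
  covering ((r - 1) * k + 1) E -> (forall v, ~ isolated E v) ->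
  k * 'C(s, r) <= #|E|.
Proof.
case: r => // r _ rE cE cV cov noiso.
have /subset_leq_card := components_complete _ _ E (ltn0Sn r) rE cE cov noiso.
apply: leq_trans; rewrite card_mono_edges //.
pose R := [set x | roots (adj E) x].
have cR : #|R| = k by rewrite -cE; apply: eq_card => x; rewrite !inE andbT.
pose F i := #|[set x | root (adj E) x == i]|.
have F0 i : i \notin R -> F i = 0.
  rewrite inE => iR; apply/eqP; rewrite cards_eq0; apply/eqP/setP=> x; rewrite !inE.
  by apply: contraNF iR => /eqP <-; apply: roots_root (adj_connect_sym E) x.
rewrite (bigID (mem R)) /= -cR; apply: leq_trans (leq_addr _ _).
apply: sum_bin_ge; rewrite cR -cV -cardsT -(sum_card_fibers (root (adj E))).
rewrite [RHS](bigID (mem R)) /= [X in _ + X]big1 ?addn0.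
  by apply: eq_bigr => i _; rewrite setTI.
by move=> i /F0; rewrite setTI.
Qed.

(** * Coverings with an isolated vertex *)

Definition independent {V : finType} (E : {set {set V}}) (I : {set V}) : bool :=
  [forall e in E, ~~ (e \subset I)].

(* Every vertex outside a maximal independent set [I] spans an edge with r - 1
   vertices of [I], and there are too few (r - 1)-subsets of [I] for all these
   to be distinct. *)
Lemma edges_sharing_face {V : finType} (r K : nat) (E : {set {set V}}) (v : V) :
  1 < r -> is_rgraph r E -> 0 < K -> covering K E -> isolated E v ->
  K + 'C(K - 2, r - 1) <= #|V| ->
  exists g : {set V}, exists u w : V,
    [/\ #|g| = r - 1, u != w, u \notin g, w \notin g &
        (u |: g \in E) && (w |: g \in E)].
Proof.
move=> r1 rE K0 cov iso cV.
have indv : independent E [set v].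
  apply/forallP=> e; apply/implyP=> eE; apply/negP=> /subset_leq_card.
  by rewrite cards1 rE // leqNgt r1.
have [I /maxsetP[indI maxI] svI] := maxset_exists indv.
have vI : v \in I by apply: (subsetP svI); rewrite inE.
have cI : #|I| < K.
  rewrite ltnNge; apply/negP=> /subset_of_card[S sSI /cov[e eE seS]].
  by move/forallP/(_ e): indI; rewrite eE (subset_trans seS).
(* The set [I] is grown from [v], which lies in no edge. Hence the (r - 1)-sets completed to edges
   avoid [v], and only K - 2 vertices remain for them. *)
pose J := I :\ v; have cJ : #|J| <= K - 2.
  by have := cardsD1 v I; rewrite vI /J; lia.
have /fin_all_exists[G Gprop] u : exists g : {set V}, u \notin I ->
    [/\ g \subset J, #|g| = r - 1 & u |: g \in E].
  case: (boolP (u \in I)) => [uI|uI]; first by exists set0.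
  have : ~~ independent E (u |: I).
    apply: contra uI => ind; rewrite -(maxI _ ind) ?setU11 //.
    exact: subsetUr.
  case/forallPn=> e; rewrite negb_imply negbK => /andP[eE seI].
  have ue : u \in e.
    apply: contraT => ue; move/forallP/(_ e): indI; rewrite eE /=.
    suff -> : e \subset I by [].
    apply/subsetP=> x xe; have := subsetP seI x xe; rewrite inE => /orP[|//].
    by rewrite inE => /eqP xu; rewrite xu (negbTE ue) in xe.
  exists (e :\ u) => _; split.
  - apply/subsetP=> x /[!inE] /andP[xu xe]; have := subsetP seI x xe.
    rewrite !inE (negbTE xu) /= => ->; rewrite andbT.
    by apply: contraTneq xe => ->; apply: iso.
  - by have := cardsD1 u e; rewrite ue (rE e eE); lia.
  - by rewrite setD1K.
(* At least n - (K - 1) vertices lie outside [I], which exceeds the number of (r - 1)-subsets of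
   [J]. *)
have : ~~ [forall u in ~: I, forall w in ~: I, (G u == G w) ==> (u == w)].
  apply/negP=> inj.
  have injG : {in ~: I &, injective G}.
    move=> u w uI wI /eqP Guw; move/forallP/(_ u)/implyP/(_ uI): inj.
    by move/forallP/(_ w)/implyP/(_ wI)/implyP/(_ Guw)/eqP.
  have := card_in_imset injG.
  have : G @: (~: I) \subset [set g : {set V} | g \subset J & #|g| == r - 1].
    apply/subsetP=> _ /imsetP[u uI ->]; rewrite inE in uI.
    by have [sG /eqP cG _] := Gprop u uI; rewrite inE sG cG.
  move/subset_leq_card; rewrite cards_draws.
  have := @leq_bin2l _ _ (r - 1) cJ.
  have := cardsC I; lia.
case/forallPn=> u; rewrite negb_imply => /andP[uI /forallPn[w]].
rewrite !negb_imply => /and3P[wI /eqP Guw uw].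
rewrite !inE in uI wI.
have [sG cG uE] := Gprop u uI; have [_ _ wE] := Gprop w wI.
have nG z : z \notin I -> z \notin G u.
  by apply: contra => /(subsetP sG); rewrite inE => /andP[].
by exists (G u), u, w; split; rewrite ?nG // uE Guw.
Qed.

Lemma isolated_connect {V : finType} (E : {set {set V}}) (v x : V) :
  isolated E v -> connect (adj E) v x -> x = v.
Proof.
move=> iso /connectP[[|y p] /=]; first by move=> _ ->.
by case/andP=> /adjP[e /iso ve [ve' _]]; rewrite ve' in ve.
Qed.

(* If u + g and w + g are edges and x is in g, then replacing x by v in u + g
   keeps x attached through w + g and attaches v. *)
Lemma isolated_fewer_components {V : finType} (r K : nat) (E : {set {set V}})
    (v : V) :
  2 < r -> is_rgraph r E -> 0 < K -> covering K E -> isolated E v ->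
  K + 'C(K - 2, r - 1) <= #|V| ->
  exists E' : {set {set V}},
    [/\ is_rgraph r E', #|E'| <= #|E|, num_components E' < num_components E &
        covering K E'].
Proof.
move=> r2 rE K0 cov iso cV.
have [g [u [w [cg uw ug wg /andP[eE fE]]]]] :=
  edges_sharing_face r K E v (ltnW r2) rE K0 cov iso cV.
set e := u |: g in eE; set f := w |: g in fE.
(* Here r >= 3 matters: [x] is to be replaced, while [y] stays in both edges and links them. *)
have [x [y [xg yg xy]]] : exists x y, [/\ x \in g, y \in g & x != y].
  by apply/card_gt1P; rewrite cg; lia.
have xe : x \in e by rewrite !inE xg orbT.
have ye : y \in e by rewrite !inE yg orbT.
have ue : u \in e by rewrite !inE eqxx.
have nfe : f != e.
  apply: contraTneq ue => <-; by rewrite !inE negb_or uw.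
have ve : v \notin e := iso e eE.
have xf : x \in f by rewrite !inE xg orbT.
have yf : y \in f by rewrite !inE yg orbT.
clearbody e f.
pose e' := v |: (e :\ x); pose E' := e' |: (E :\ e).
have e'E : e' \in E' by rewrite !inE eqxx.
have keep h : h \in E -> h != e -> h \in E' by move=> hE he; rewrite !inE he hE orbT.
have yx : y \in e' by rewrite !inE ye (eq_sym y x) xy orbT.
(* The vertices of the lost edge [e] stay connected: [x] reaches [y] through [f], the others through
   [e']. *)
have exy z : z \in e -> connect (adj E') z y.
  move=> ze; case: (eqVneq z x) => [->|zx].
    by apply: (connect_edge E' f); rewrite ?keep.
  by apply: connect_edge e'E _ yx; rewrite !inE zx ze orbT.
have cE := cardsD1 e E; rewrite eE in cE.
exists E'; split.
- move=> h /[!inE] /orP[/eqP ->|/andP[_ /rE//]].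
  rewrite cardsU1 !inE (negbTE ve) andbF /=.
  by rewrite -(rE e eE) [RHS](cardsD1 x) xe.
- by rewrite cardsU1 cE; case: (_ \notin _).
- apply: (num_components_lt E E' v y).
  + apply: connect_sub => a b /adjP[h hE [ah bh]].
    case: (eqVneq h e) => [he|he]; last exact: connect_edge (keep h hE he) ah bh.
    rewrite he in ah bh; apply: connect_trans (exy a ah) _.
    by rewrite (adj_connect_sym E') exy.
  + by apply: connect_edge e'E _ yx; rewrite !inE eqxx.
  + by apply: contra ve => /(isolated_connect E v y iso) <-.
- move=> S cS; case: (boolP (v \in S)) => vS.
    have [h hE hS] := cov S cS; case: (eqVneq h e) => [he|he]; last first.
      by exists h => //; apply: keep.
    exists e' => //; rewrite subUset sub1set vS.
    by apply: subset_trans (subsetDl _ _) _; rewrite -he.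
  case: (boolP (x \in S)) => xS; last first.
    have [h hE hS] := cov S cS; exists h => //; apply: keep => //.
    by apply: contraNneq xS => he; apply: (subsetP hS); rewrite he.
  (* The edge found avoids [v], which is isolated, and avoids [x]; so it lies in [S] and differs
     from [e]. *)
  have [|h hE hS] := cov (v |: (S :\ x)).
    by rewrite cardsU1 !inE (negbTE vS) andbF /= -cS [RHS](cardsD1 x) xS.
  have xh : x \notin h.
    apply/negP=> /(subsetP hS); rewrite !inE eqxx orbF => /eqP xv.
    by rewrite -xv xe in ve.
  exists h; first by apply: keep => //; apply: contraNneq xh => ->.
  apply/subsetP=> z zh; have := subsetP hS z zh; rewrite !inE.
  by case/orP=> [/eqP zv|/andP[]//]; rewrite zv (negbTE (iso h hE)) in zh.
Qed.

(** * Trading edges between two classes *)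

Definition cone {V : finType} (P X : {set V}) : {set {set V}} :=
  [set x |: P | x in X].

Lemma coneP {V : finType} (P X e : {set V}) :
  reflect (exists2 x, x \in X & e = x |: P) (e \in cone P X).
Proof. exact: imsetP. Qed.

Lemma card_cone {V : finType} (P X : {set V}) :
  [disjoint X & P] -> #|cone P X| = #|X|.
Proof.
move=> XP; apply: card_in_imset => x y xX yX /setP/(_ x).
by rewrite !inE eqxx (disjointFr XP xX) !orbF => /esym/eqP.
Qed.

(* [P] and [Q] are (r - 1)-subsets of the classes [A] and [B]; the edges
   P + a (a in A) and Q + b (b in B) are traded for P + b and Q + a. *)
Definition swapped {V : finType} (E : {set {set V}}) (A B P Q : {set V}) :
    {set {set V}} :=
  (E :\: (cone P (A :\: P) :|: cone Q (B :\: Q)))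
    :|: (cone P (B :\: Q) :|: cone Q (A :\: P)).

Lemma swappedC {V : finType} (E : {set {set V}}) (A B P Q : {set V}) :
  swapped E A B P Q = swapped E B A Q P.
Proof. by rewrite /swapped [cone P _ :|: cone Q _]setUC [cone P _ :|: cone Q _]setUC. Qed.

(** Every edge given up in the trade contains [P] or [Q]. *)
Lemma swapped_keep {V : finType} (E : {set {set V}}) (A B P Q e : {set V}) :
  e \in E -> ~~ (P \subset e) -> ~~ (Q \subset e) -> e \in swapped E A B P Q.
Proof.
move=> eE Pe Qe; rewrite !inE eE andbT.
suff -> : (e \in cone P (A :\: P)) || (e \in cone Q (B :\: Q)) = false by [].
apply/negP=> /orP[] /coneP[x _ ex]; first by rewrite ex subsetUr in Pe.
by rewrite ex subsetUr in Qe.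
Qed.

Lemma mem_mono_edges {V T : finType} (r : nat) (c : V -> T) (e : {set V}) (l : T) :
  #|e| = r -> e \subset [set x | c x == l] -> e \in mono_edges r c.
Proof. by move=> ce se; rewrite inE ce eqxx; apply/existsP; exists l. Qed.

Lemma classes_disjoint {V T : finType} (c : V -> T) (X Y : {set V}) (l m : T) :
  l != m -> X \subset [set x | c x == l] -> Y \subset [set x | c x == m] ->
  [disjoint X & Y].
Proof.
move=> lm sX sY; apply/pred0P=> x /=; apply/negP=> /andP[xX xY].
have := subsetP sX x xX; have := subsetP sY x xY; rewrite !inE => /eqP -> ml.
by rewrite eq_sym ml in lm.
Qed.

(** Since 2 < r < s, any two vertices of a class lie in a common [r]-subset of it. *)
Lemma mono_connect {V T : finType} (r s : nat) (c : V -> T) :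
  2 < r -> r < s -> (forall l, #|[set x | c x == l]| = s) ->
  forall x y, connect (adj (mono_edges r c)) x y = (c x == c y).
Proof.
move=> r3 rs cC x y.
apply/idP/eqP.
  apply: connect_invariant => {}x {}y /adjP[e /[!inE] /andP[_ /existsP[l /subsetP se]]].
  by case=> /se/[!inE]/eqP-> /se/[!inE]/eqP->.
move=> cxy; have [||e [xye sel ce]] := @subset_between V [set x; y] [set z | c z == c x] r.
- by rewrite subUset !sub1set !inE cxy eqxx.
- by rewrite cC (ltnW rs) andbT cards2; lia.
apply: (connect_edge _ e); first exact: mem_mono_edges ce sel.
  by apply: (subsetP xye); rewrite !inE eqxx.
by apply: (subsetP xye); rewrite !inE eqxx orbT.
Qed.

Section Swap.

Context {V T : finType} (r s : nat) (c : V -> T) (i j : T) (P Q : {set V}).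
Let C i := [set x | c x == i].
Hypotheses (r3 : 2 < r) (rs : r < s) (cC : forall l, #|C l| = s) (ij : i != j).
Hypotheses (sP : P \subset C i) (sQ : Q \subset C j).
Hypotheses (cP : #|P| = r - 1) (cQ : #|Q| = r - 1).

Let E := mono_edges r c.
Let E' := swapped E (C i) (C j) P Q.

Let r1 : 0 < r := ltnW (ltnW r3).
Let P1 : 1 < #|P|. Proof. by rewrite cP ltn_subRL. Qed.
Let Q1 : 1 < #|Q|. Proof. by rewrite cQ ltn_subRL. Qed.
Let rP : r = #|P|.+1. Proof. by rewrite cP subn1 prednK. Qed.

Lemma swap_cone_mono (X : {set V}) (l : T) :
  #|X| = r - 1 -> X \subset C l -> cone X (C l :\: X) \subset E.
Proof.
move=> cX sX; apply/subsetP=> e /coneP[x /setDP[xl xX] ->].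
apply: (mem_mono_edges _ _ _ l); first by by rewrite cardsU1 xX cX subnKC.
by rewrite subUset sub1set xl.
Qed.

Lemma swapped_rgraph : is_rgraph r E'.
Proof.
have cn (X Y : {set V}) : #|X| = r - 1 -> [disjoint Y & X] ->
    forall e, e \in cone X Y -> #|e| = r.
  move=> cX YX e /coneP[x xY ->]; by rewrite cardsU1 (disjointFr YX xY) cX subnKC.
move=> e; rewrite inE => /orP[|/setUP[]].
- by rewrite !inE => /andP[_ /andP[/eqP]].
- apply: cn => //; rewrite disjoint_sym.
  exact: classes_disjoint ij sP (subsetDl _ _).
- apply: cn => //; exact: classes_disjoint ij (subsetDl _ _) sQ.
Qed.

(** The removed cones are disjoint parts of [E], so their sizes add up exactly; the added cones have
    at most the same total size. *)
Lemma card_swapped_le : #|E'| <= #|E|.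
Proof.
have dPQ : [disjoint cone P (C i :\: P) & cone Q (C j :\: Q)].
  apply/pred0P=> e /=; apply/negP=> /andP[/coneP[x xi ->] /coneP[y yj /setP exy]].
  have /card_gt0P[z zP] := ltnW P1.
  have dis : [disjoint P & y |: Q].
    apply: classes_disjoint ij sP _; rewrite subUset sub1set sQ andbT.
    by case/setDP: yj.
  by have := exy z; rewrite !inE zP orbT => /esym; rewrite -in_set1 -in_setU (disjointFr dis zP).
have dd (X Y : {set V}) : [disjoint Y :\: X & X].
  by rewrite -setI_eq0 setDE -setIA [~: X :&: X]setIC setICr setI0.
have sc : cone P (C i :\: P) :|: cone Q (C j :\: Q) \subset E.
  by rewrite subUset !swap_cone_mono.
have cD : #|cone P (C i :\: P) :|: cone Q (C j :\: Q)| = #|C i :\: P| + #|C j :\: Q|.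
  rewrite -(card_cone _ _ (dd P (C i))) -(card_cone _ _ (dd Q (C j))).
  by apply/eqP; rewrite (leq_card_setU _ _).
apply: leq_trans (leq_card_setU _ _) _.
rewrite cardsD (setIidPr sc) cD.
have h1 : #|cone P (C j :\: Q) :|: cone Q (C i :\: P)| <= #|C j :\: Q| + #|C i :\: P|.
  apply: leq_trans (leq_card_setU _ _) _.
  by apply: leq_add; apply: leq_imset_card.
have := subset_leq_card sc; rewrite cD => h2.
by rewrite addnC in h1; rewrite -(subnK h2) addnK leq_add2l.
Qed.

Lemma exists_outside (z : V) : exists z', [&& z' \in C i, z' \notin P & z' != z].
Proof.
have : ~~ (C i \subset z |: P).
  apply/negP=> /subset_leq_card; rewrite cC cardsU1 cP; case: (_ \notin _) => /=; lia.
by case/subsetPn=> z' zi /[!inE] /norP[zz zP]; exists z'; rewrite zi zP.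
Qed.

(** The lost edge P + z is bypassed: some [b] in [P] other than [a] is exchanged for a vertex [z']
    of the class outside P + z. The new edge contains neither [P] nor [Q], so it survives, and it
    still joins [a] to [z]. *)
Lemma swapped_connect_cone (z a : V) :
  z \in C i :\: P -> a \in z |: P -> connect (adj E') a z.
Proof.
case/setDP=> zi zP; rewrite !inE => /orP[/eqP-> //|aP].
have [z' /and3P[z'i z'P zz']] := exists_outside z.
have [b bP ba] : exists2 b, b \in P & b != a.
  have /card_gt1P[b1 [b2 [b1P b2P b12]]] := P1.
  by case: (eqVneq b1 a) => [<-|]; [exists b2; rewrite // eq_sym | exists b1].
pose e := z' |: (z |: (P :\ b)).
have zb : z != b by apply: contraNneq zP => ->.
have z'b : z' != b by apply: contraNneq z'P => ->.
have sei : e \subset C i.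
  by rewrite !subUset !sub1set z'i zi (subset_trans (subsetDl _ _) sP).
have ce : #|e| = r.
  rewrite !cardsU1 !inE (negbTE zz') (negbTE z'P) (negbTE zP) !andbF /=.
  by rewrite [RHS]rP (cardsD1 b P) bP.
have eE' : e \in E'.
  apply: swapped_keep; first exact: mem_mono_edges ce sei.
    apply/subsetPn; exists b => //; rewrite !inE eqxx /= orbF.
    by rewrite ![b == _]eq_sym (negbTE zb) (negbTE z'b).
  have /card_gt0P[q qQ] := ltnW Q1.
  apply/subsetPn; exists q => //; rewrite (disjointFr _ qQ) // disjoint_sym.
  exact: classes_disjoint ij sei sQ.
by apply: connect_edge eE' _ _; rewrite !inE ?eqxx ?orbT // aP (eq_sym a b) ba !orbT.
Qed.

(* If an edgeless S has r vertices in class i, these are P and one further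
   vertex a; then S misses C j minus Q because of the edges P + b, and it does
   not contain Q because of Q + a. *)
Lemma swapped_independent_le (S : {set V}) :
  (forall e, e \in E' -> ~~ (e \subset S)) -> r <= #|S :&: C i| ->
  #|S :&: C i| + #|S :&: C j| <= (r - 1) + (r - 1).
Proof.
move=> ind rSi.
have noQ (h : {set V}) : h \subset C i -> ~~ (Q \subset h).
  move=> sh; have /card_gt0P[q qQ] := ltnW Q1.
  apply/subsetPn; exists q => //; rewrite (disjointFr _ qQ) // disjoint_sym.
  exact: classes_disjoint ij sh sQ.
have sSi : S :&: C i \subset C i by apply: subsetIr.
(* An [r]-subset of class [i] without [P] is an edge untouched by the trade. *)
have full (h : {set V}) : h \subset S :&: C i -> #|h| = r -> P \subset h.
  move=> sh ch; apply: contraT => Ph.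
  have shi := subset_trans sh sSi.
  have := ind h (swapped_keep _ _ _ _ _ _ (mem_mono_edges _ _ _ i ch shi) Ph (noQ _ shi)).
  by rewrite (subset_trans sh (subsetIl _ _)).
(* With more than r vertices, one vertex [b] of [P] could be avoided, giving an [r]-subset that
   misses part of [P]. *)
have cSi : #|S :&: C i| = r.
  apply/eqP; rewrite eqn_leq rSi andbT leqNgt; apply/negP=> lt.
  have /card_gt0P[b bP] := ltnW P1.
  have [|h sh ch] := subset_of_card ((S :&: C i) :\ b) r.
    by move: lt; rewrite (cardsD1 b (S :&: C i)); case: (_ \in _) => // /ltnW.
  have := subsetP (full h (subset_trans sh (subsetDl _ _)) ch) b bP.
  by move/(subsetP sh); rewrite !inE eqxx.
have PS := full _ (subxx _) cSi.
have [a aSi aP] : exists2 a, a \in S :&: C i & a \notin P.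
  by apply/subsetPn; apply/negP=> /subset_leq_card; rewrite cSi rP ltnn.
have [aS ai] := setIP aSi.
have sPS : P \subset S := subset_trans PS (subsetIl _ _).
have SQ : S :&: C j \subset Q.
  apply/subsetP=> b /setIP[bS bj]; apply: contraT => bQ.
  have /ind : b |: P \in E'.
    rewrite !in_setU; apply/orP; right; apply/orP; left.
    by apply/coneP; exists b => //; rewrite in_setD bQ.
  by rewrite subUset sub1set bS sPS.
have nQS : ~~ (Q \subset S).
  have /ind : a |: Q \in E'.
    rewrite !in_setU; apply/orP; right; apply/orP; right.
    by apply/coneP; exists a => //; rewrite in_setD aP.
  by rewrite subUset sub1set aS.
have : S :&: C j \proper Q.
  rewrite properE SQ; apply: contra nQS => /subset_trans; apply; exact: subsetIl.
move/proper_card; rewrite cQ cSi => lt.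
by rewrite -{1}(subnK r1) -addnA leq_add2l add1n.
Qed.

Lemma swapped_cross : exists x y, [/\ c x = i, c y = j & connect (adj E') x y].
Proof.
have /card_gt0P[p pP] := ltnW P1.
have [b bj bQ] : exists2 b, b \in C j & b \notin Q.
  by apply/subsetPn; apply/negP=> /subset_leq_card; rewrite cC cQ leqNgt (leq_ltn_trans (leq_subr _ _) rs).
exists p, b; split.
- by move: (subsetP sP p pP); rewrite inE => /eqP.
- by move: bj; rewrite inE => /eqP.
have bPE' : b |: P \in E'.
  rewrite !in_setU; apply/orP; right; apply/orP; left.
  by apply/coneP; exists b => //; rewrite in_setD bQ.
by apply: connect_edge bPE' _ _; rewrite in_setU1 ?pP ?eqxx ?orbT.
Qed.

End Swap.

(** * Effect of the trade on components and covering *)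

Section SwapTwo.

Context {V T : finType} (r s : nat) (c : V -> T) (i j : T) (P Q : {set V}).
Let C i := [set x | c x == i].
Hypotheses (r3 : 2 < r) (rs : r < s) (cC : forall l, #|C l| = s) (ij : i != j).
Hypotheses (sP : P \subset C i) (sQ : Q \subset C j).
Hypotheses (cP : #|P| = r - 1) (cQ : #|Q| = r - 1).

Let E := mono_edges r c.
Let E' := swapped E (C i) (C j) P Q.

(** Each lost edge belongs to one of two cones, and all its vertices still reach the apex [z]. The
    cone over [Q] is the cone over [P] with the roles of the classes exchanged, which is why [i],
    [j], [P], [Q] are instantiated afresh. *)
Lemma swapped_connect : subrel (connect (adj E)) (connect (adj E')).
Proof.
have ji : j != i by rewrite eq_sym.
apply: connect_sub => a b /adjP[e eE [ae be]].
case: (boolP (e \in E')) => [eE'|]; first exact: connect_edge eE' ae be.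
rewrite in_setU in_setD eE andbT negb_or negbK => /andP[/setUP[] /coneP[z zC ez] _].
- rewrite ez in ae be.
  have h := swapped_connect_cone r s c i j P Q r3 rs cC ij sP sQ cP cQ z.
  apply: connect_trans (h a zC ae) _.
  by rewrite (adj_connect_sym E') h.
- rewrite ez in ae be.
  have h := swapped_connect_cone r s c j i Q P r3 rs cC ji sQ sP cQ cP z.
  rewrite -swappedC in h.
  apply: connect_trans (h a zC ae) _.
  by rewrite (adj_connect_sym E') h.
Qed.

Lemma swapped_fewer_components : num_components E' < num_components E.
Proof.
have [x [y [cx cy xy]]] := swapped_cross r s c i j P Q r3 rs cC sP cP cQ.
apply: (num_components_lt E E' x y) => //; first exact: swapped_connect.
by rewrite (mono_connect r s c) // cx cy.
Qed.

(** An edgeless set has at most 2(r - 1) vertices in classes [i] and [j] together. It has at most r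
    - 1 in any other class, whose [r]-subsets contain neither [P] nor [Q] and are kept. The total is
    too small by one. *)
Lemma swapped_covering : covering ((r - 1) * #|T| + 1) E'.
Proof.
have ji : j != i by rewrite eq_sym.
move=> S cS; case: (boolP [exists e in E', e \subset S]).
  by case/existsP=> e /andP[eE' eS]; exists e.
move=> no; have ind e : e \in E' -> ~~ (e \subset S).
  by move=> eE'; apply: contra no => eS; apply/existsP; exists e; rewrite eE'.
have hij : #|S :&: C i| + #|S :&: C j| <= (r - 1) + (r - 1).
  case: (leqP r #|S :&: C i|) => hi.
    exact: swapped_independent_le ind hi.
  case: (leqP r #|S :&: C j|) => hj; last first.
    by apply: leq_add; rewrite -ltnS subn1 prednK // ltnW // ltnW.
  rewrite addnC; apply: (swapped_independent_le r c j i Q P) => //.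
  by rewrite -swappedC.
have hl l : l != i -> l != j -> #|S :&: C l| <= r - 1.
  move=> li lj; rewrite -ltnS; rewrite subn1 prednK; last exact: ltnW (ltnW r3).
  rewrite ltnNge; apply/negP=> /subset_of_card[h sh ch].
  have shl := subset_trans sh (subsetIr _ _).
  have noX (X : {set V}) m : l != m -> X \subset C m -> #|X| = r - 1 -> ~~ (X \subset h).
    move=> lm sX cX; have /card_gt0P[q qX] : 0 < #|X| by rewrite cX subn_gt0 ltnW.
    apply/subsetPn; exists q => //; rewrite (disjointFr _ qX) // disjoint_sym.
    exact: (classes_disjoint c _ _ l m).
  have := ind h (swapped_keep E _ _ _ _ h (mem_mono_edges r c h l ch shl)
     (noX P i li sP cP) (noX Q j lj sQ cQ)).
  by rewrite (subset_trans sh (subsetIl _ _)).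
suff : #|S| <= (r - 1) * #|T| by rewrite cS addn1 ltnn.
rewrite -(sum_card_fibers c S) mulnC -sum_nat_const.
rewrite (bigD1 i) //= (bigD1 j) //= [X in _ <= X](bigD1 i) //= [X in _ <= _ + X](bigD1 j) //=.
by rewrite !addnA leq_add // leq_sum // => l /andP[li lj]; apply: hl.
Qed.

End SwapTwo.

(** * Disjoint cliques of equal size and the final comparison *)

Lemma equitable_coloring {V : finType} (k s : nat) :
  #|V| = k * s ->
  exists c : V -> 'I_k, forall i, #|[set x | c x == i]| = s.
Proof.
move=> cV; have eqc : #|V| = #|{: 'I_k * 'I_s}| by rewrite card_prod !card_ord.
pose f x := enum_val (cast_ord eqc (enum_rank x)).
have fbij : bijective f.
  exists (fun p => enum_val (cast_ord (esym eqc) (enum_rank p))) => x.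
    by rewrite /f enum_valK cast_ordK enum_rankK.
  by rewrite /f enum_valK cast_ordKV enum_rankK.
exists (fun x => (f x).1) => i.
have -> : [set x | (f x).1 == i] = f @^-1: setX [set i] setT.
  by apply/setP=> x; rewrite !inE andbT.
rewrite on_card_preimset; last exact: onW_bij.
by rewrite cardsX cards1 cardsT card_ord mul1n.
Qed.

Lemma leq_bin_middle (n m : nat) : 0 < m < n -> n <= 'C(n, m).
Proof.
elim: n m => // n IH [//|m] /andP[_]; rewrite ltnS leq_eqVlt => /orP[/eqP <-|lt].
  by rewrite binSn.
have := IH m.+1 lt; have : 0 < 'C(n, m) by rewrite bin_gt0 ltnW // ltnW.
by rewrite binS; lia.
Qed.

(** Realizability is restated as a boolean predicate over finitely many edge sets, so that a least
    [t] can be extracted. *)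
Lemma is_turan_exists (r n K m t : nat) :
  turan_realizable r n K m t -> exists2 t0, is_turan r n K m t0 & t0 <= t.
Proof.
pose ok t (E : {set {set 'I_n}}) := [&& [forall e in E, #|e| == r], #|E| == t,
  num_components E == m &
  [forall (S : {set 'I_n} | #|S| == K), exists e in E, e \subset S]].
have okP t' : reflect (turan_realizable r n K m t') [exists E, ok t' E].
  apply: (iffP existsP) => [[E /and4P[rE /eqP cE /eqP nE cov]]|[E [rE cE nE cov]]];
    exists E.
    split=> // [e eE|S cS].
      by move/forallP/(_ e)/implyP/(_ eE)/eqP: rE.
    move/forallP/(_ S)/implyP: cov => /(_ (introT eqP cS))/existsP[e /andP[eE eS]].
    by exists e.
  apply/and4P; split; [| exact/eqP | exact/eqP |].
    by apply/forallP=> e; apply/implyP=> eE; apply/eqP/rE.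
  apply/forallP=> S; apply/implyP=> /eqP/cov[e eE eS].
  by apply/existsP; exists e; rewrite eE.
move/okP=> Pt; have ex : exists t', [exists E, ok t' E] by exists t.
case: (ex_minnP ex) => t0 /okP Pt0 min; exists t0; last exact: min.
by split=> // t' /okP; apply: min.
Qed.

(** Pigeonhole: some class receives at least r vertices of the set. *)
Lemma mono_covering {V T : finType} (r : nat) (c : V -> T) :
  0 < r -> covering ((r - 1) * #|T| + 1) (mono_edges r c).
Proof.
move=> r0 S cS.
case: (boolP [exists l, r <= #|S :&: [set x | c x == l]|]) => [/existsP[l]|no].
  case/subset_of_card=> h sh ch; exists h; last exact: subset_trans sh (subsetIl _ _).
  rewrite inE ch eqxx; apply/existsP; exists l.
  exact: subset_trans sh (subsetIr _ _).
have : \sum_l #|S :&: [set x | c x == l]| <= \sum_(l : T) (r - 1).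
  apply: leq_sum => l _; rewrite -ltnS subn1 prednK // ltnNge.
  by apply: contra no => rl; apply/existsP; exists l.
by rewrite sum_card_fibers cS sum_nat_const mulnC addn1 ltnn.
Qed.

Lemma mono_num_components {V : finType} (r k s : nat) (c : V -> 'I_k) :
  2 < r -> r < s -> (forall i, #|[set x | c x == i]| = s) ->
  num_components (mono_edges r c) = k.
Proof.
move=> r2 rs cc; rewrite -[RHS]card_ord; apply: (num_components_classes _ c).
  exact: mono_connect r2 rs cc.
move=> i; have /card_gt0P[x] : 0 < #|[set x | c x == i]|.
  by rewrite cc; apply: leq_trans rs.
by rewrite inE => /eqP; exists x.
Qed.

(** The new graph is not derived from [E]: it is the trade applied to [k] equal cliques, which have
    at most as many edges as [E]. *)
Lemma no_isolated_fewer_components {V : finType} (r k s : nat)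
    (E : {set {set V}}) :
  2 < r -> 1 < k -> r < s -> is_rgraph r E -> num_components E = k ->
  #|V| = k * s -> covering ((r - 1) * k + 1) E -> (forall v, ~ isolated E v) ->
  exists E' : {set {set V}},
    [/\ is_rgraph r E', #|E'| <= #|E|, num_components E' < k &
        covering ((r - 1) * k + 1) E'].
Proof.
move=> r2 k1 rs rE nE cV cov noiso.
have r0 : 0 < r by lia.
have [c cc] := equitable_coloring k s cV.
have nM := mono_num_components r k s c r2 rs cc.
pose i := Ordinal (ltnW k1); pose j := Ordinal k1.
have ij : i != j by [].
have hs l : r - 1 <= #|[set x | c x == l]| by rewrite cc; lia.
have [P sP cP] := subset_of_card _ _ (hs i).
have [Q sQ cQ] := subset_of_card _ _ (hs j).
exists (swapped (mono_edges r c) [set x | c x == i] [set x | c x == j] P Q).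
split.
- exact: swapped_rgraph ij sP sQ cP cQ.
- apply: leq_trans (no_isolated_card r k s E r0 rE nE cV cov noiso).
  apply: leq_trans (card_swapped_le r c i j P Q _ ij sP sQ cP cQ) _ => //.
  rewrite card_mono_edges // (eq_bigr (fun=> 'C(s, r))); last by move=> l _; rewrite cc.
  by rewrite sum_nat_const card_ord.
- rewrite -[X in _ < X]nM.
  exact: swapped_fewer_components r2 rs cc ij sP sQ cP cQ.
- rewrite -[X in _ * X]card_ord.
  exact: swapped_covering r2 ij sP sQ cP cQ.
Qed.

Theorem theorem1p2 (r k n : nat) (hr : 3 <= r) (hk : 2 <= k)
    (hn : (r - 1) * k + 1 + 'C((r - 1) * k - 1, r - 1) <= n)
    (hkn : k %| n) :
  exists m : nat, 1 <= m < k /\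
    exists tk tm : nat,
      [/\ is_turan r n ((r - 1) * k + 1) k tk,
          is_turan r n ((r - 1) * k + 1) m tm
        & tk >= tm].
Proof.
set K := (r - 1) * k + 1.
have [s ns] : exists s, n = k * s by exists (n %/ k); rewrite mulnC divnK.
have cV : #|'I_n| = k * s by rewrite card_ord.
(* The binomial coefficient is at least (r - 1)k - 1, so ks >= 2(r - 1)k, and 2(r - 1) > r because r
   >= 3. *)
have rs : r < s.
  have : (r - 1) * k - 1 <= 'C((r - 1) * k - 1, r - 1).
    by apply: leq_bin_middle; nia.
  nia.
have cVK : K + 'C(K - 2, r - 1) <= #|'I_n|.
  by rewrite card_ord /K; have -> : (r - 1) * k + 1 - 2 = (r - 1) * k - 1 by lia.
have [c cc] := equitable_coloring k s cV.
(* The [k] equal cliques show that the minimum for [k] components exists. *)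
have [|tk Tk _] := @is_turan_exists r n K k #|mono_edges r c|.
  exists (mono_edges r c); split=> //.
  - by move=> e; rewrite inE => /andP[/eqP].
  - exact: mono_num_components cc.
  - by rewrite /K -[X in _ * X]card_ord; apply: mono_covering; apply: ltnW (ltnW hr).
have [[E [rE cE nE cov]] _] := Tk.
have [E' [rE' cE' nE' cov']] : exists E' : {set {set 'I_n}},
    [/\ is_rgraph r E', #|E'| <= #|E|, num_components E' < k & covering K E'].
  case: (boolP [exists v, [forall e in E, v \notin e]]) => [/existsP[v vE]|noiso].
    have iso : isolated E v by move=> e eE; move/forallP/(_ e)/implyP: vE; apply.
    have [|E' [rE' cE' nE' cov']] := isolated_fewer_components r K E v hr rE _ cov iso cVK.
      by rewrite /K addn1.
    by exists E'; rewrite nE in nE'.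
  apply: (no_isolated_fewer_components r k s E) => // v iso.
  move/existsPn/(_ v)/negP: noiso; apply.
  by apply/forallP=> e; apply/implyP; apply: iso.
have n0 : 0 < n by apply: leq_trans hn; rewrite addn1.
(* The witness m is the number of components of [E'], whose edge count bounds the minimum for that
   m. *)
have [tm Tm le] := is_turan_exists r n K (num_components E') #|E'|
  (ex_intro _ E' (And4 rE' erefl erefl cov')).
exists (num_components E'); split.
  by rewrite (num_components_gt0 E' (Ordinal n0)).
by exists tk, tm; split=> //; apply: leq_trans le _; rewrite -cE.
Qed.
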